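(* Let $p,q,k>0$ be real numbers with $kp<1$ and $kq>1$, let $T_c>0$, and put $m_p=\frac{1-kp}{q-p}$, $m_q=\frac{kq-1}{q-p}$, $K=\frac{\Gamma(m_p)\Gamma(m_q)}{\Gamma(k)(q-p)}$. For $\varrho>0$ set $\alpha=\varrho$, $\beta=\frac1\varrho$ and $$\gamma(\varrho)=\frac{\Gamma(m_p)\,\Gamma(m_q)}{\alpha^{k}\,\Gamma(k)\,(q-p)}\left(\frac{\alpha}{\beta}\right)^{m_p},$$ and define $$T_{\max}(\varrho)=\frac{T_c}{\gamma(\varrho)}\left(\frac{1}{\alpha^k(1-pk)}+\frac{1}{\beta^k(qk-1)}\right)=\frac{T_c}{K}\left(\frac{1}{\varrho^{2m_p}(1-pk)}+\frac{\varrho^{2(k-m_p)}}{qk-1}\right).$$ Then: (1) for every $\varrho>0$, the settling-time function $T$ of the scalar system $\dot x=-\frac{\gamma(\varrho)}{T_c}\left(\alpha|x|^{p}+\beta|x|^{q}\right)^{k}\operatorname{sign}(x)$, $x(0)=x_0$, satisfies $\sup_{x_0\in\mathbb{R}}T(x_0)=T_c$; (2) $\lim_{\varrho\to0^+}T_{\max}(\varrho)=\lim_{\varrho\to+\infty}T_{\max}(\varrho)=+\infty$; (3) $\arg\min_{\varrho>0}T_{\max}(\varrho)=1$, and $$\min_{\varrho>0}T_{\max}(\varrho)=T_{\max}(1)=\frac{T_c}{K}\left(\frac{1}{1-pk}+\frac{1}{qk-1}\right)>T_c.$$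
   Context: $\Gamma(z)=\int_0^{+\infty}e^{-t}t^{z-1}\,dt$ is the Gamma function. The settling-time function of the system is $T(x_0)=\inf\{T\ge 0 : x(t,x_0)=0\ \forall t\ge T\}$, where $x(t,x_0)$ is the solution starting at $x_0$. *)

(* Defs.v *)
From HB Require Import structures.
From mathcomp Require Import all_boot all_order all_algebra.
From mathcomp Require Import all_classical all_reals all_analysis.

Set Implicit Arguments.
Unset Strict Implicit.
Unset Printing Implicit Defensive.

Import Order.TTheory GRing.Theory Num.Theory.
Import numFieldNormedType.Exports.

Local Open Scope classical_set_scope.
Local Open Scope ring_scope.

Definition Gamma (R : realType) (z : R) : R :=
  Rintegral lebesgue_measure `]0, +oo[
    (fun t : R => expR (- t) * t `^ (z - 1)).

(* x solves x' = f x, x(0) = x0 on [0, +oo[; the values of x at negative times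
   are irrelevant.  When f is continuous, the right derivative of x at 0 is
   then f x0, by the mean value theorem. *)
Definition is_solution (R : realType) (f : R -> R) (x0 : R) (x : R -> R) : Prop :=
  [/\ x 0 = x0,
      {within `[0, +oo[, continuous x}
    & forall t : R, 0 < t -> is_derive t 1 x (f (x t))].

(* phi x0 is the unique forward solution starting at x0, for every x0. *)
Definition is_solution_map (R : realType) (f : R -> R) (phi : R -> R -> R) : Prop :=
  forall x0 : R, is_solution f x0 (phi x0) /\
    forall y : R -> R, is_solution f x0 y ->
      forall t : R, 0 <= t -> y t = phi x0 t.

(* Extended real: +oo when x never settles at 0. *)
Definition settling_time (R : realType) (x : R -> R) : \bar R :=
  ereal_inf [set T%:E | T in
    [set T : R | 0 <= T /\ forall t : R, T <= t -> x t = 0]].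

Definition argmin (R : realType) (A : set R) (f : R -> R) : set R :=
  [set a | A a /\ forall b, A b -> f a <= f b].

Definition is_min (R : realType) (A : set R) (f : R -> R) (m : R) : Prop :=
  (f @` A) m /\ lbound (f @` A) m.

Definition mp (R : realType) (p q k : R) : R := (1 - k * p) / (q - p).

Definition mq (R : realType) (p q k : R) : R := (k * q - 1) / (q - p).

Definition K (R : realType) (p q k : R) : R :=
  Gamma (mp p q k) * Gamma (mq p q k) / (Gamma k * (q - p)).

Definition gain (R : realType) (p q k alpha beta : R) : R :=
  Gamma (mp p q k) * Gamma (mq p q k) / (alpha `^ k * Gamma k * (q - p))
  * (alpha / beta) `^ mp p q k.

Definition vector_field (R : realType) (p q k Tc alpha beta : R) (x : R) : R :=
  - (gain p q k alpha beta / Tc)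
  * (alpha * `|x| `^ p + beta * `|x| `^ q) `^ k * Num.sg x.

Definition Tmax (R : realType) (p q k Tc rho : R) : R :=
  let alpha := rho in
  let beta := rho^-1 in
  Tc / gain p q k alpha beta
  * ((alpha `^ k * (1 - p * k))^-1 + (beta `^ k * (q * k - 1))^-1).

(* Main.v *)
Require Import Defs.
From HB Require Import structures.
From mathcomp Require Import all_boot all_order all_algebra.
From mathcomp Require Import all_classical all_reals all_analysis.
From mathcomp Require Import measurable_realfun ring lra.

Set Implicit Arguments.
Unset Strict Implicit.
Unset Printing Implicit Defensive.

Import Order.TTheory GRing.Theory Num.Theory.
Import numFieldNormedType.Exports.

Local Open Scope classical_set_scope.
Local Open Scope ring_scope.

(** Write a = mp, b = mq, so that a + b = k, and let g be the speed, so that the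
vector field is - g |x| sgn x.  In the variable w = (beta / alpha) x ^ (q - p) the
time element dx / g x becomes a constant multiple of the beta prime density
w ^ (a - 1) (1 + w) ^ - (a + b) dw.  By Tonelli and the scaling of Lebesgue measure
([Gamma_mul_beta_prime]) its integral over the half line is
Gamma a Gamma b / Gamma (a + b), and the gain is exactly the constant for which the
time needed to descend from x to 0, called [arrival], is Tc times the distribution
function of that law.  Arrival times are therefore bounded by Tc and approach Tc as
x grows.

Solutions of the differential equation are obtained by inverting the arrival time F:
from x0, the state at time t is the point whose arrival time is the remaining time
F |x0| - t, with the sign of x0, and it is 0 once no time remains.  At the arrival
instant this curve is differentiable with derivative 0 because x <= F x * g x and g
vanishes at 0 ([separable_settling]).  Forward uniqueness holds because the field is
nonincreasing, so that the squared distance of two solutions cannot grow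
([is_solution_unique]).

Up to the factor Tc / K, Tmax is the function [scaling_cost],
(rho ^ (- 2 a) / a + rho ^ (2 b) / b) / (q - p).  Applying 1 + u < exp u to
u = - 2 a ln rho and to u = 2 b ln rho, and weighting by 1 / a and 1 / b, the linear
terms cancel, which gives the strict minimum at 1.  Finally Tc < Tmax 1 says that the
Beta integral is smaller than 1 / a + 1 / b; this follows from a strict comparison
of the beta prime density with the derivative of an explicit function that grows from
- 1 / b to 1 / a ([beta_integral_lt]). *)

(** * Integrals over the open half line *)

(** A density that is singular at 0 is treated as the limit of its integrals over closed
rays, on which it is continuous and the integration theorems for continuous functions
apply. *)
Lemma cvg_integral_ray (R : realType) (f : R -> R) (c : R) : 0 < c ->
  {in `]0 : R, +oo[, continuous f} -> (forall x : R, 0 < x -> 0 <= f x) ->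
  (\int[lebesgue_measure]_(x in `[(c * n.+1%:R^-1)%R, +oo[) (f x)%:E)%E
    @[n --> \oo] --> (\int[lebesgue_measure]_(x in `]0%R, +oo[) (f x)%:E)%E.
Proof.
move=> c0 cf f0.
have cn0 n : 0 < c * n.+1%:R^-1 by rewrite mulr_gt0// invr_gt0.
have -> : (`]0, +oo[%classic : set R) =
    \bigcup_n (`[c * n.+1%:R^-1, +oo[%classic : set R).
  apply/seteqP; split => x /=; rewrite in_itv/= andbT.
    move=> x0; near \oo => n; exists n => //=; rewrite in_itv/= andbT.
    rewrite ler_pdivrMr// mulrC -ler_pdivrMr//.
    rewrite (le_trans (ltW (truncnS_gt _)))// ler_nat ltnS.
    by near: n; exact: nbhs_infty_ge.
  by move=> [n _] /=; rewrite in_itv/= andbT; apply: lt_le_trans.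
have mf : measurable_fun `](0 : R), +oo[ f.
  apply: open_continuous_measurable_fun => //.
  by move=> x /set_mem; exact: cf.
apply: ge0_nondecreasing_set_cvg_integral => //.
- apply/nondecreasing_seqP => n; apply/subsetPset => x /=.
  rewrite !in_itv/= !andbT; apply: le_trans.
  by rewrite ler_pM2l// lef_pV2 ?posrE// ler_nat.
- move=> n; apply/measurable_EFinP; apply: measurable_funS mf => //.
  by move=> x /=; rewrite !in_itv/= !andbT; exact: lt_le_trans.
- move=> n x /=; rewrite in_itv/= andbT => h; rewrite lee_fin f0//.
  exact: lt_le_trans h.
Unshelve. all: by end_near. Qed.

Lemma integral_scale (R : realType) (f : R -> R) (c : R) : 0 < c ->
  {in `]0 : R, +oo[, continuous f} -> (forall x : R, 0 < x -> 0 <= f x) ->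
  (\int[lebesgue_measure]_(x in `]0%R, +oo[) (f x)%:E =
   \int[lebesgue_measure]_(x in `]0%R, +oo[) (c * f (c * x))%R%:E)%E.
Proof.
move=> c0 cf f0.
have dM : derive1 (fun x : R => c * x) = cst c.
  by apply/funext => x; rewrite derive1E derive_val /GRing.scale/= mulr1.
have cM (x : R) : {for x, continuous (fun y => c * y)}.
  by apply: cvgM; [exact: cvg_cst|exact: cvg_id].
have cfc : {in `]0 : R, +oo[, continuous (fun x => c * f (c * x))}.
  move=> x; rewrite in_itv/= andbT => x0; apply: cvgM; first exact: cvg_cst.
  apply: (@continuous_comp _ _ _ (fun y => c * y) f); first exact: cM.
  by apply: cf; rewrite in_itv/= andbT mulr_gt0.
have := @cvg_integral_ray _ _ 1 ltr01 cfc.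
rewrite (_ : (fun n => _) = (fun n =>
   (\int[lebesgue_measure]_(x in `[(c * n.+1%:R^-1)%R, +oo[) (f x)%:E)%E)).
  move=> h; apply: (cvg_unique _ (cvg_integral_ray c0 cf f0) (h _)) => //.
  by move=> x x0; rewrite mulr_ge0 ?f0 ?mulr_gt0// ltW.
apply/funext => n; rewrite mul1r; apply/esym.
have n0 : (0 : R) < n.+1%:R^-1 by rewrite invr_gt0.
rewrite (@increasing_ge0_integration_by_substitutiony _ (fun x => c * x) f).
- apply: eq_integral => x _; congr (_%:E).
  by rewrite dM /= mulrC.
- by move=> x y _ _; rewrite ltr_pM2l.
- by rewrite dM => x _; exact: cst_continuous.
- by rewrite dM; exact: is_cvg_cst.
- by rewrite dM; exact: is_cvg_cst.
- split.
    by move=> x _; apply: ex_derive.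
  by apply: cvg_at_right_filter; exact: cM.
- exact/(gt0_cvgMry c0)/cvg_id.
- apply: continuous_in_subspaceT => x /set_mem/=; rewrite in_itv/= andbT => cx.
  by apply: cf; rewrite in_itv/= andbT (lt_le_trans _ cx)// mulr_gt0.
- move=> x; rewrite in_itv/= andbT => cx.
  by rewrite f0// (lt_trans _ cx)// mulr_gt0.
Qed.

(** Tonelli on a rectangle, from the theorem on the whole plane applied to the extension by
0 of the integrand. *)
Lemma tonelli_on (R : realType) (A B : set R) (f : R -> R -> R) :
  measurable A -> measurable B ->
  measurable_fun setT (fun z : R * R => f z.1 z.2) ->
  (forall x y, A x -> B y -> 0 <= f x y) ->
  (\int[lebesgue_measure]_(x in A) \int[lebesgue_measure]_(y in B) (f x y)%:E =
   \int[lebesgue_measure]_(y in B) \int[lebesgue_measure]_(x in A) (f x y)%:E)%E.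
Proof.
move=> mA mB mf f0.
pose k := (fun z : R * R => (f z.1 z.2)%:E) \_ (A `*` B).
have kE x y : k (x, y) = if (x \in A) && (y \in B) then (f x y)%:E else 0%E.
  by rewrite /k patchE in_setX.
rewrite integral_mkcond [RHS]integral_mkcond.
transitivity (\int[lebesgue_measure]_x \int[lebesgue_measure]_y k (x, y))%E.
  apply: eq_integral => x _; rewrite patchE; case: ifPn => xA.
    rewrite integral_mkcond; apply: eq_integral => y _.
    by rewrite kE xA patchE.
  by rewrite integral0_eq// => y _; rewrite kE (negbTE xA).
rewrite fubini_tonelli//; last 2 first.
- apply/measurable_restrict => //; first exact: measurableX.
  by apply/measurable_EFinP; apply: measurable_funS mf => //.
- move=> [x y]; rewrite kE; case: ifPn => // /andP[/set_mem xA /set_mem yB].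
  by rewrite lee_fin f0.
apply: eq_integral => y _; rewrite patchE; case: ifPn => yB.
  rewrite [RHS]integral_mkcond; apply: eq_integral => x _.
  by rewrite kE yB andbT patchE.
by rewrite integral0_eq// => x _; rewrite kE (negbTE yB) andbF.
Qed.

(** * Gamma and Beta integrals *)

Definition gamma_density (R : realType) (a t : R) : R := expR (- t) * t `^ (a - 1).

Definition beta_prime (R : realType) (a b u : R) : R :=
  u `^ (a - 1) * (1 + u) `^ (- (a + b)).

Lemma continuous_powR_gt0 (R : realType) (a x : R) : 0 < x ->
  {for x, continuous (fun y : R => y `^ a)}.
Proof.
move=> x0; have := @is_derive1_powR R a x x0.
by move=> [+ _] => /derivable1_diffP/differentiable_continuous.
Qed.

Lemma gamma_density_ge0 (R : realType) (a t : R) : 0 <= gamma_density a t.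
Proof. by rewrite mulr_ge0 ?expR_ge0 ?powR_ge0. Qed.

Lemma beta_prime_ge0 (R : realType) (a b u : R) : 0 <= beta_prime a b u.
Proof. by rewrite mulr_ge0 ?powR_ge0. Qed.

Lemma continuous_gamma_density (R : realType) (a : R) :
  {in `]0 : R, +oo[, continuous (gamma_density a)}.
Proof.
move=> x; rewrite in_itv/= andbT => x0; apply: cvgM.
  apply: (@continuous_comp _ _ _ -%R expR); first exact: continuousN.
  exact: continuous_expR.
exact: continuous_powR_gt0.
Qed.

Lemma continuous_beta_prime (R : realType) (a b : R) :
  {in `]0 : R, +oo[, continuous (beta_prime a b)}.
Proof.
move=> x; rewrite in_itv/= andbT => x0; apply: cvgM.
  exact: continuous_powR_gt0.
have := @continuous_comp R R R (fun u => 1 + u) (fun y => y `^ (- (a + b))) x.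
apply; first by apply: cvgD; [exact: cvg_cst|exact: cvg_id].
by apply: continuous_powR_gt0; rewrite addr_gt0.
Qed.

Lemma measurable_beta_prime (R : realType) (a b : R) :
  measurable_fun setT (beta_prime a b).
Proof.
apply: measurable_funM; first exact: measurable_powR.
by apply: (measurableT_comp (measurable_powR _)); exact: measurable_funD.
Qed.

Lemma measurable_EFin_beta_prime (R : realType) (a b : R) (D : set R) :
  measurable_fun D (EFin \o beta_prime a b).
Proof.
by apply/measurable_EFinP; apply: measurable_funTS; exact: measurable_beta_prime.
Qed.

Lemma measurable_gamma_density (R : realType) (a : R) :
  measurable_fun setT (gamma_density a).
Proof.
apply: measurable_funM; last exact: measurable_powR.
exact: measurableT_comp.
Qed.

Lemma measurable_EFin_gamma_density (R : realType) (a : R) (D : set R) :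
  measurable_fun D (EFin \o gamma_density a).
Proof.
by apply/measurable_EFinP; apply: measurable_funTS; exact: measurable_gamma_density.
Qed.

(** In the double integral of exp (- s - t) s ^ (a - 1) t ^ (b - 1), substitute s = t u in
the inner integral, exchange the order, and then substitute t = v / (1 + u): the
variables v and u separate. *)
Lemma Gamma_mul_beta_prime (R : realType) (a b : R) :
  (\int[lebesgue_measure]_(t in `]0%R, +oo[) (gamma_density a t)%:E *
   \int[lebesgue_measure]_(t in `]0%R, +oo[) (gamma_density b t)%:E =
   \int[lebesgue_measure]_(t in `]0%R, +oo[) (gamma_density (a + b) t)%:E *
   \int[lebesgue_measure]_(u in `]0%R, +oo[) (beta_prime a b u)%:E)%E.
Proof.
have gd0 := @gamma_density_ge0 R; have bp0 := @beta_prime_ge0 R.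
set G := fun c : R => (\int[lebesgue_measure]_(t in `]0%R, +oo[) (gamma_density c t)%:E)%E.
rewrite -/(G a) -/(G b) -/(G (a + b)).
have G0 c : (0 <= G c)%E by apply: integral_ge0 => t _; rewrite lee_fin.
pose h t u : R := expR (- (t * (1 + u))) * t `^ (a + b - 1) * u `^ (a - 1).
transitivity (\int[lebesgue_measure]_(t in `]0%R, +oo[)
    \int[lebesgue_measure]_(u in `]0%R, +oo[) (h t u)%:E)%E.
  rewrite -ge0_integralZl//; last 2 first.
  - exact: measurable_EFin_gamma_density.
  - by move=> t _; rewrite lee_fin.
  apply: eq_integral => t; rewrite inE/= in_itv/= andbT => t0.
  (* the substitution s = t u *)
  rewrite muleC {1}/G (@integral_scale _ (gamma_density a) t t0)//; last 1 first.
    exact: continuous_gamma_density.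
  rewrite -ge0_integralZl//; last 3 first.
  - apply/measurable_EFinP; apply: measurable_funM => //.
    by apply: (measurableT_comp (measurable_gamma_density _)); exact: measurable_funM.
  - by move=> u; rewrite /= in_itv/= andbT => u0; rewrite lee_fin mulr_ge0// ltW.
  - by rewrite lee_fin.
  apply: eq_integral => u; rewrite inE/= in_itv/= andbT => u0.
  rewrite -EFinM; congr (_%:E); rewrite /h /gamma_density.
  rewrite powRM ?ltW// mulrDr mulr1 opprD expRD.
  have -> : a + b - 1 = 1 + (a - 1) + (b - 1) by ring.
  move: (a - 1) (b - 1) => a' b'.
  rewrite !powRD ?(gt_eqF t0) ?implybT// powRr1 ?ltW//.
  ring.
rewrite tonelli_on//; last 2 first.
- apply: measurable_funM; last first.
    by apply: (measurableT_comp (measurable_powR _)); exact: measurable_snd.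
  apply: measurable_funM; last first.
    by apply: (measurableT_comp (measurable_powR _)); exact: measurable_fst.
  apply: measurableT_comp => //; apply: measurableT_comp => //.
  by apply: measurable_funM => //; exact: measurable_funD.
- by move=> t u _ _; rewrite !mulr_ge0 ?expR_ge0 ?powR_ge0.
rewrite -ge0_integralZl//; last 2 first.
- exact: measurable_EFin_beta_prime.
- by move=> u _; rewrite lee_fin.
apply: eq_integral => u; rewrite inE/= in_itv/= andbT => u0.
have u10 : 0 < 1 + u by rewrite addr_gt0.
(* the substitution v = (1 + u) t *)
rewrite /G (@integral_scale _ (gamma_density (a + b)) (1 + u) u10)//; last first.
  exact: continuous_gamma_density.
rewrite muleC -ge0_integralZl//; last 3 first.
- apply/measurable_EFinP; apply: measurable_funM => //.
  by apply: (measurableT_comp (measurable_gamma_density _)); exact: measurable_funM.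
- by move=> t _; rewrite lee_fin mulr_ge0// ltW.
- by rewrite lee_fin.
apply: eq_integral => t; rewrite inE/= in_itv/= andbT => t0.
rewrite -EFinM; congr (_%:E); rewrite /h /gamma_density /beta_prime.
have -> : (1 + u) `^ (- (a + b)) = ((1 + u) `^ (a + b - 1) * (1 + u))^-1.
  rewrite powRN -{3}(powRr1 (ltW u10)) -powRD ?subrK//.
  by rewrite (gt_eqF u10) implybT.
rewrite (mulrC t) powRM ?ltW//.
have : (1 + u) `^ (a + b - 1) != 0 by rewrite gt_eqF ?powR_gt0.
have : 1 + u != 0 by rewrite gt_eqF.
by move=> ? ?; field; apply/andP.
Qed.

(** * Finiteness and size of the Beta integral *)

Lemma cvg_powR_pinfty (R : realType) (r : R) : 0 < r ->
  x `^ r @[x --> +oo] --> +oo.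
Proof.
move=> r0; apply/cvgryPge => A; near=> x.
have x0 : 0 <= x by near: x; apply: nbhs_pinfty_ge; exact: num_real.
have [A0|A0] := leP A 0; first exact: le_trans (powR_ge0 _ _).
rewrite -(powRr1 (ltW A0)) -(mulVf (lt0r_neq0 r0)) powRrM.
apply: ge0_ler_powR => //; rewrite ?nnegrE ?powR_ge0 ?ltW//.
Unshelve. all: end_near. Qed.

Lemma cvg_powRN_pinfty (R : realType) (r : R) : 0 < r ->
  x `^ (- r) @[x --> +oo] --> (0 : R).
Proof.
move=> r0; under eq_cvg do rewrite powRN.
apply/gtr0_cvgV0; last exact: cvg_powR_pinfty.
near=> x; apply: powR_gt0.
near: x; apply: nbhs_pinfty_gt; exact: num_real.
Unshelve. all: end_near. Qed.

Lemma is_derive_powR1D (R : realType) (c u : R) : 0 < u ->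
  is_derive u 1 (fun v => (1 + v) `^ c) (c * (1 + u) `^ (c - 1)).
Proof.
move=> u0; have u10 : 0 < 1 + u by rewrite addr_gt0.
have d1 : is_derive u 1 (fun v : R => 1 + v) 1.
  by have := is_deriveD (is_derive_cst (1 : R) u 1) (is_derive_id u (1 : R)); rewrite add0r.
have := @is_derive1_comp R (fun y => y `^ c) (fun v => 1 + v) u _ 1
  (is_derive1_powR c u10) d1.
by rewrite mulr1.
Qed.

Lemma continuous_powR1D (R : realType) (c u : R) : 0 < u ->
  {for u, continuous (fun v : R => (1 + v) `^ c)}.
Proof.
move=> u0; have [+ _] := is_derive_powR1D c u0.
by move/derivable1_diffP/differentiable_continuous.
Qed.

(** Splitting a beta prime density f as f / (1 + u) + u f / (1 + u), each summand is
bounded by the corresponding one here, which has an elementary primitive. *)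
Definition beta_majorant (R : realType) (a b u : R) : R :=
  u `^ (a - 1) * (1 + u) `^ (- a - 1) + (1 + u) `^ (- b - 1).

(** The first summand is (u / (1 + u)) ^ a / a, written with powers of u and 1 + u. *)
Definition beta_majorant_primitive (R : realType) (a b u : R) : R :=
  a^-1 * (u `^ a * (1 + u) `^ (- a)) - b^-1 * (1 + u) `^ (- b).

Lemma powR_subr1 (R : realType) (a u : R) : 0 < u -> u `^ (a - 1) = u `^ a / u.
Proof.
move=> u0; rewrite powRB ?powRr1 ?ltW//.
by rewrite (gt_eqF u0) implybT.
Qed.

(** After division by common factors the two comparisons are (1 + u) ^ (- b) < 1 and
(u / (1 + u)) ^ a <= 1. *)
Lemma beta_prime_lt_majorant (R : realType) (a b u : R) :
  0 < a -> 0 < b -> 0 < u -> beta_prime a b u < beta_majorant a b u.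
Proof.
move=> a0 b0 u0; have x0 : 0 < 1 + u by rewrite addr_gt0.
rewrite /beta_prime /beta_majorant !powR_subr1//.
have -> : (1 + u) `^ (- (a + b)) = (1 + u) `^ (- a) * (1 + u) `^ (- b).
  by rewrite -powRD ?opprD// (gt_eqF x0) implybT.
set U := u `^ a; set P := (1 + u) `^ (- a); set Q := (1 + u) `^ (- b).
have U0 : 0 < U by exact: powR_gt0.
have P0 : 0 < P by exact: powR_gt0.
have Q0 : 0 < Q by exact: powR_gt0.
have Q1 : Q < 1.
  have b1 : (1 : R) `^ b = 1 by rewrite powR1.
  rewrite /Q powRN invf_lt1 ?powR_gt0// -[ltLHS]b1.
  by apply: gt0_ltr_powR => //; rewrite ?nnegrE ?ltW// ltrDl.
have UP1 : U * P <= 1.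
  rewrite /P powRN ler_pdivrMr ?powR_gt0// mul1r.
  by apply: ge0_ler_powR; rewrite ?nnegrE ?ltW// ltrDr.
have e : U / u * (P / (1 + u)) + Q / (1 + u) - U / u * (P * Q)
     = (U * P * (1 - Q) / u + Q * (1 - U * P)) / (1 + u).
  by field; rewrite !gt_eqF.
rewrite -subr_gt0 e divr_gt0// ltr_wpDr//.
  by rewrite mulr_ge0 ?(ltW Q0)// subr_ge0.
by rewrite divr_gt0// mulr_gt0 ?subr_gt0// mulr_gt0.
Qed.

Lemma is_derive_beta_majorant (R : realType) (a b u : R) :
  0 < a -> 0 < b -> 0 < u ->
  is_derive u 1 (beta_majorant_primitive a b) (beta_majorant a b u).
Proof.
move=> a0 b0 u0; have x0 : 0 < 1 + u by rewrite addr_gt0.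
have dP := is_derive_powR1D (- a) u0; have dQ := is_derive_powR1D (- b) u0.
have dU := is_derive1_powR a u0.
have dUP := @is_deriveZ _ _ _ _ (a^-1) _ _ _ (is_deriveM dU dP).
have dF := @is_deriveD _ _ _ _ _ _ _ _ _ dUP
  (@is_deriveZ _ _ _ _ (- b^-1) _ _ _ dQ).
rewrite (_ : beta_majorant_primitive a b =
  (a^-1 \*: ((powR (R:=R))^~ a * (fun v => (1 + v) `^ (- a))) +
   - b^-1 \*: (fun v => (1 + v) `^ (- b)))); last first.
  by apply/funext => v; rewrite /beta_majorant_primitive -mulNr.
apply: (is_derive_eq dF).
rewrite /beta_majorant /GRing.scale/= !powR_subr1//.
by field; rewrite !gt_eqF.
Qed.

Lemma beta_majorant_primitive_cvg (R : realType) (a b : R) : 0 < a -> 0 < b ->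
  beta_majorant_primitive a b u @[u --> +oo] --> a^-1.
Proof.
move=> a0 b0.
have cvg1 : 1 + u @[u --> (+oo : set_system R)] --> +oo by exact: cvg_addrl.
rewrite -[X in _ --> X]subr0; apply: cvgB; last first.
  rewrite -[X in _ --> X](mulr0 b^-1); apply: cvgM; first exact: cvg_cst.
  have := cvg_comp (fun u : R => 1 + u) (fun y => y `^ (- b)) cvg1.
  by apply; exact: cvg_powRN_pinfty.
rewrite -[X in _ --> X](mulr1 a^-1); apply: cvgM; first exact: cvg_cst.
have h : 1 - (1 + u)^-1 @[u --> (+oo : set_system R)] --> (1 : R).
  rewrite -[X in _ --> X]subr0; apply: cvgB; first exact: cvg_cst.
  apply/gtr0_cvgV0 => //; near=> u; rewrite addr_gt0//.
have := cvg_comp (fun u : R => 1 - (1 + u)^-1) (fun y => y `^ a) h.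
move=> /(_ _ (@continuous_powR_gt0 R a 1 ltr01)); rewrite powR1.
apply: cvg_trans; apply: near_eq_cvg; near=> u => /=.
have u0 : 0 < u by near: u; apply: nbhs_pinfty_gt; exact: num_real.
have u10 : 0 < 1 + u by rewrite addr_gt0.
have -> : 1 - (1 + u)^-1 = u / (1 + u) by field; rewrite gt_eqF.
by rewrite powRM ?invr_ge0 ?(ltW u0) ?(ltW u10)// -powR_inv1 ?ltW// -powRrM mulN1r.
Unshelve. all: end_near. Qed.

Lemma beta_majorant_primitive_ge (R : realType) (a b u : R) :
  0 < a -> 0 < b -> 0 < u -> - b^-1 <= beta_majorant_primitive a b u.
Proof.
move=> a0 b0 u0; have x0 : 0 < 1 + u by rewrite addr_gt0.
rewrite /beta_majorant_primitive -[leLHS]add0r lerD//.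
  by rewrite !mulr_ge0 ?invr_ge0 ?powR_ge0// ltW.
rewrite lerN2 ler_piMr ?invr_ge0 ?(ltW b0)// powRN invf_le1 ?powR_gt0//.
have b1 : (1 : R) `^ b = 1 by rewrite powR1.
by rewrite -[leLHS]b1 ge0_ler_powR ?nnegrE ?(ltW b0) ?(ltW x0)// lerDl ltW.
Qed.

Lemma beta_majorant_primitive_le (R : realType) (a b u : R) :
  0 < a -> 0 < b -> 0 < u -> beta_majorant_primitive a b u <= a^-1.
Proof.
move=> a0 b0 u0; have x0 : 0 < 1 + u by rewrite addr_gt0.
rewrite /beta_majorant_primitive -[leRHS]subr0 lerB//.
  rewrite ler_piMr ?invr_ge0 ?(ltW a0)// powRN ler_pdivrMr ?powR_gt0// mul1r.
  by rewrite ge0_ler_powR ?nnegrE ?(ltW a0) ?(ltW x0) ?(ltW u0)// lerDr.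
by rewrite mulr_ge0 ?invr_ge0 ?powR_ge0// ltW.
Qed.

Lemma beta_majorant_ge0 (R : realType) (a b u : R) : 0 <= beta_majorant a b u.
Proof. by rewrite addr_ge0 ?mulr_ge0 ?powR_ge0. Qed.

Lemma continuous_beta_majorant (R : realType) (a b : R) :
  {in `]0 : R, +oo[, continuous (beta_majorant a b)}.
Proof.
move=> u; rewrite in_itv/= andbT => u0; apply: cvgD.
  by apply: cvgM; [exact: continuous_powR_gt0|exact: continuous_powR1D].
exact: continuous_powR1D.
Qed.

(** The primitive of the majorant increases by at most 1 / a + 1 / b over every ray. *)
Lemma integral_beta_prime_le (R : realType) (a b : R) : 0 < a -> 0 < b ->
  (\int[lebesgue_measure]_(u in `]0%R, +oo[) (beta_prime a b u)%:E
    <= (a^-1 + b^-1)%:E)%E.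
Proof.
move=> a0 b0.
have cvgI := @cvg_integral_ray R _ 1 ltr01 (@continuous_beta_prime R a b)
  (fun u _ => beta_prime_ge0 a b u).
rewrite -(cvg_lim _ cvgI)//; apply: lime_le.
  by apply/cvg_ex; eexists; exact: cvgI.
apply: nearW => n; rewrite mul1r; set e : R := n.+1%:R^-1.
have e0 : 0 < e by rewrite invr_gt0.
have eP (u : R) : e <= u -> 0 < u by exact: lt_le_trans.
have cM : {within `[e, +oo[, continuous (beta_majorant a b)}.
  apply: continuous_in_subspaceT => u /set_mem/=; rewrite in_itv/= andbT => eu.
  by apply: continuous_beta_majorant; rewrite in_itv/= andbT eP.
apply: (@le_trans _ _ (\int[lebesgue_measure]_(u in `[e, +oo[) (beta_majorant a b u)%:E)%E).
  apply: ge0_le_integral => //.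
  - by move=> u _; rewrite lee_fin beta_prime_ge0.
  - exact: measurable_EFin_beta_prime.
  - by apply/measurable_EFinP; exact: subspace_continuous_measurable_fun.
  - move=> u; rewrite /= in_itv/= andbT => /eP u0.
    by rewrite lee_fin ltW// beta_prime_lt_majorant.
rewrite (@ge0_continuous_FTC2y _ _ (beta_majorant_primitive a b) _ a^-1)//.
- rewrite -EFinB lee_fin lerD2l lerNl.
  exact: beta_majorant_primitive_ge.
- by move=> u _; exact: beta_majorant_ge0.
- exact: beta_majorant_primitive_cvg.
- move=> u eu; have [] // := is_derive_beta_majorant a0 b0 (eP _ (ltW eu)).
- have [+ _] := is_derive_beta_majorant a0 b0 e0.
  move/derivable1_diffP/differentiable_continuous => h.
  exact: cvg_at_right_filter.
- move=> u; rewrite in_itv/= andbT => eu; rewrite derive1E.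
  by have [_] := is_derive_beta_majorant a0 b0 (eP _ (ltW eu)).
Qed.

Lemma integrable_beta_prime (R : realType) (a b : R) : 0 < a -> 0 < b ->
  lebesgue_measure.-integrable `[0%R, +oo[ (EFin \o beta_prime a b).
Proof.
move=> a0 b0; have mf := measurable_EFin_beta_prime a b.
apply/integrableP; split; first exact: mf.
rewrite (_ : (fun x => _) = EFin \o beta_prime a b); last first.
  by apply/funext => u /=; rewrite ger0_norm// beta_prime_ge0.
rewrite -integral_itv_obnd_cbnd; last exact: mf.
exact: le_lt_trans (integral_beta_prime_le a0 b0) (ltry _).
Qed.

(** * The distribution function of the beta prime density *)

Definition beta_integral (R : realType) (a b : R) : R :=
  Rintegral lebesgue_measure `]0, +oo[ (beta_prime a b).

(** This is not normalised: its limit at infinity is the Beta integral, not 1. *)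
Definition beta_cdf (R : realType) (a b w : R) : R :=
  Rintegral lebesgue_measure `[0, w] (beta_prime a b).

Section beta_cdf.
Variables (R : realType) (a b : R).
Hypotheses (a0 : 0 < a) (b0 : 0 < b).

Let integrable_seg (w : R) :
  lebesgue_measure.-integrable `[0, w] (EFin \o beta_prime a b).
Proof.
apply: integrableS (integrable_beta_prime a0 b0) => //.
exact: subset_itvl.
Qed.

Lemma beta_integralE : (beta_integral a b)%:E =
  (\int[lebesgue_measure]_(u in `[0%R, +oo[) (beta_prime a b u)%:E)%E.
Proof.
rewrite /beta_integral /Rintegral integral_itv_obnd_cbnd.
  by rewrite fineK// integrable_fin_num// integrable_beta_prime.
exact: measurable_EFin_beta_prime.
Qed.

Lemma beta_cdfE (w : R) : (beta_cdf a b w)%:E =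
  (\int[lebesgue_measure]_(u in `[0%R, w]) (beta_prime a b u)%:E)%E.
Proof. by rewrite fineK// integrable_fin_num. Qed.

Lemma beta_cdf0 : beta_cdf a b 0 = 0.
Proof. by rewrite /beta_cdf set_itv1 Rintegral_set1. Qed.

Lemma beta_cdf_le_total w : beta_cdf a b w <= beta_integral a b.
Proof.
rewrite -lee_fin beta_cdfE beta_integralE; apply: ge0_subset_integral => //.
- exact: measurable_EFin_beta_prime.
- by move=> u _; rewrite lee_fin beta_prime_ge0.
- exact: subset_itvl.
Qed.

Lemma beta_cdf_approx (M e : R) : 0 < e ->
  exists2 w, M < w & beta_integral a b - e < beta_cdf a b w.
Proof.
move=> e0.
have mT : measurable_fun setT (beta_prime a b) by exact: measurable_beta_prime.
have h := @ge0_cvgn_integral R lebesgue_measure (beta_prime a b) (@beta_prime_ge0 R a b) mT.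
rewrite -beta_integralE in h.
have /fine_cvgP[_ h'] : (beta_cdf a b n%:R)%:E @[n --> \oo] --> (beta_integral a b)%:E.
  by rewrite (funext (fun n : nat => beta_cdfE n%:R)).
have : \forall n \near \oo, beta_integral a b - e < beta_cdf a b n%:R.
  by apply: (cvgr_gt _ h'); rewrite ltrBlDr ltrDl.
move=> hn; near \oo => n; exists n%:R; last by near: n.
by near: n; exact: nbhs_infty_gtr.
Unshelve. all: end_near. Qed.

Lemma is_derive_beta_cdf (w : R) : 0 < w ->
  is_derive w 1 (beta_cdf a b) (beta_prime a b w).
Proof.
move=> w0; have w1 : w < w + 1 by rewrite ltrDl.
have cw : {for w, continuous (beta_prime a b)}.
  by apply: continuous_beta_prime; rewrite in_itv/= andbT.
have [d1 d2] := continuous_FTC1_closed w1 (integrable_seg (w + 1)) w0 cw.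
by split; [exact: d1|rewrite -derive1E; exact: d2].
Qed.

Lemma beta_cdf_cvg0 : beta_cdf a b w @[w --> 0^'+] --> 0.
Proof.
have := parameterized_integral_continuous ler01 (integrable_seg 1).
move=> /(continuous_within_itvP _ ltr01)[_ + _].
by rewrite /parameterized_integral -/(beta_cdf a b 0) beta_cdf0.
Qed.

(** The difference D between the primitive of the majorant and the distribution function
is strictly increasing on the positive reals.  Its limit at 0 is at least - 1 / b, its limit
at infinity is at most 1 / a minus the Beta integral, and D 1 < D 2 makes the inequality strict. *)
Lemma beta_integral_lt : beta_integral a b < a^-1 + b^-1.
Proof.
pose D w := beta_majorant_primitive a b w - beta_cdf a b w.
have dD (w : R) : 0 < w -> is_derive w 1 D (beta_majorant a b w - beta_prime a b w).
  move=> w0.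
  exact: is_deriveB (is_derive_beta_majorant a0 b0 w0) (is_derive_beta_cdf w0).
have D_incr (x y : R) : 0 < x -> x < y -> D x < D y.
  move=> x0 xy; apply: (@gtr0_derive1_incr _ D x y) => //.
  - by move=> z; rewrite in_itv/= => /andP[xz _]; have [] := dD _ (lt_trans x0 xz).
  - move=> z; rewrite in_itv/= => /andP[xz _]; have z0 := lt_trans x0 xz.
    have [_] := dD _ z0; rewrite derive1E => ->.
    by rewrite subr_gt0 beta_prime_lt_majorant.
  - apply: derivable_within_continuous => z; rewrite in_itv/= => /andP[xz _].
    by have [] := dD _ (lt_le_trans x0 xz).
have D1 : - b^-1 <= D 1.
  apply/ler_addgt0Pr => e e0.
  have he : \forall w \near 0^'+, beta_cdf a b w < e.
    by apply: (cvgr_lt _ beta_cdf_cvg0).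
  near (0 : R)^'+ => w.
  have w0 : 0 < w by [].
  have : D w < D 1 by apply: D_incr => //; near: w; exact: nbhs_right_lt.
  have : beta_cdf a b w < e by near: w.
  have := beta_majorant_primitive_ge a0 b0 w0.
  rewrite {1}/D; lra.
have D12 : D 1 < D 2 by apply: D_incr; rewrite ?ltr1n.
have D2 : beta_integral a b <= a^-1 - D 2.
  apply/ler_addgt0Pr => e e0.
  have [w w2 tw] := beta_cdf_approx 2 e0.
  have := D_incr 2 w (ltr0n _ 2) w2.
  have := beta_majorant_primitive_le a0 b0 (lt_trans (ltr0n _ 2) w2).
  rewrite {2}/D; lra.
lra.
Unshelve. all: end_near. Qed.
End beta_cdf.

(** * The Gamma function at positive arguments *)

(** The tangent inequality y <= exp (y - 1) at y = (1 + t) / r, raised to the power r. *)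
Lemma powR1D_le_expR (R : realType) (r t : R) : 0 < r -> 0 < t ->
  (1 + t) `^ r <= r `^ r * expR (1 + t - r).
Proof.
move=> r0 t0; have x0 : 0 < 1 + t by rewrite addr_gt0.
have y0 : 0 <= (1 + t) / r by rewrite divr_ge0// ltW.
rewrite -{1}(divfK (lt0r_neq0 r0) (1 + t)) mulrC powRM ?(ltW r0)//.
rewrite ler_pM2l ?powR_gt0//.
have -> : 1 + t - r = ((1 + t) / r - 1) * r by field; rewrite gt_eqF.
rewrite expRM ge0_ler_powR ?nnegrE ?(ltW r0) ?expR_ge0//.
by rewrite (le_trans _ (expR_ge1Dx _))// addrCA subrr addr0.
Qed.

(** This reduces the finiteness of Gamma a to that of a Beta integral, since exp (- t) beats
every power of 1 + t. *)
Lemma gamma_density_le (R : realType) (a t : R) : 0 < a -> 0 < t ->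
  gamma_density a t <= (a + 1) `^ (a + 1) * expR (- a) * beta_prime a 1 t.
Proof.
move=> a0 t0; have a1 : 0 < a + 1 by rewrite addr_gt0.
have x0 : 0 < 1 + t by rewrite addr_gt0.
rewrite /gamma_density /beta_prime mulrC [leRHS]mulrCA ler_pM2l ?powR_gt0//.
rewrite powRN ler_pdivlMr ?powR_gt0// mulrC -ler_pdivlMr ?expR_gt0//.
rewrite (le_trans (powR1D_le_expR a1 t0))// -mulrA ler_pM2l ?powR_gt0//.
by rewrite -expRN -expRD ler_expR opprK; lra.
Qed.

Lemma integrable_gamma_density (R : realType) (a : R) : 0 < a ->
  lebesgue_measure.-integrable `]0%R, +oo[ (EFin \o gamma_density a).
Proof.
move=> a0; set C := (a + 1) `^ (a + 1) * expR (- a).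
have iB : lebesgue_measure.-integrable `]0%R, +oo[ (EFin \o beta_prime a 1).
  apply: integrableS (integrable_beta_prime a0 (@ltr01 R)) => //.
  by move=> t /=; rewrite !in_itv/= !andbT; exact: ltW.
apply: (le_integrable _ _ _ (integrableZl _ C iB)) => //.
  exact: measurable_EFin_gamma_density.
move=> t; rewrite /= in_itv/= andbT => t0; rewrite lee_fin.
rewrite ger0_norm ?gamma_density_ge0// ger0_norm ?gamma_density_le//.
by rewrite !mulr_ge0 ?powR_ge0 ?expR_ge0.
Qed.

Lemma GammaE (R : realType) (a : R) : 0 < a -> (Gamma a)%:E =
  (\int[lebesgue_measure]_(t in `]0%R, +oo[) (gamma_density a t)%:E)%E.
Proof.
by move=> a0; rewrite fineK// integrable_fin_num//; exact: integrable_gamma_density.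
Qed.

(** On the interval [1, 2] the integrand is at least exp (- 2) / 2, because
t ^ (a - 1) = t ^ a / t. *)
Lemma Gamma_gt0 (R : realType) (a : R) : 0 < a -> 0 < Gamma a.
Proof.
move=> a0; apply: (@lt_le_trans _ _ (expR (- 2) / 2)).
  by rewrite divr_gt0 ?expR_gt0.
rewrite -lee_fin GammaE//.
apply: (@le_trans _ _ (\int[lebesgue_measure]_(t in `[1%R, 2%R]) (gamma_density a t)%:E)%E).
  apply: (@le_trans _ _ (\int[lebesgue_measure]_(t in `[1%R : R, 2%R]) (expR (- 2) / 2)%:E)%E).
    rewrite integral_cst//= lebesgue_measure_itv/= lte_fin ltr1n -EFinB -EFinM.
    rewrite lee_fin; lra.
  apply: ge0_le_integral => //.
  - exact: measurable_EFin_gamma_density.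
  - move=> t; rewrite /= in_itv/= => /andP[t1 t2].
    have t0 : 0 < t by exact: lt_le_trans t1.
    rewrite lee_fin ler_pM ?invr_ge0 ?expR_ge0//; first by rewrite ler_expR lerN2.
    rewrite powR_subr1// -[leLHS]mul1r ler_pM ?invr_ge0//.
      have b1 : (1 : R) `^ a = 1 by rewrite powR1.
      by rewrite -[leLHS]b1 ge0_ler_powR ?nnegrE ?(ltW a0) ?(ltW t0).
    by rewrite lef_pV2 ?posrE.
apply: ge0_subset_integral => //.
- exact: measurable_EFin_gamma_density.
- by move=> t _; rewrite lee_fin gamma_density_ge0.
- by move=> t /=; rewrite !in_itv/= andbT => /andP[t1 _]; exact: lt_le_trans t1.
Qed.

Lemma beta_integral_Gamma (R : realType) (a b : R) : 0 < a -> 0 < b ->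
  beta_integral a b = Gamma a * Gamma b / Gamma (a + b).
Proof.
move=> a0 b0; have ab0 : 0 < a + b by rewrite addr_gt0.
(* the equations are composed as terms: rewriting would try to unfold the integrals *)
have bt : (beta_integral a b)%:E =
    (\int[lebesgue_measure]_(u in `]0%R, +oo[) (beta_prime a b u)%:E)%E.
  rewrite integral_itv_obnd_cbnd; first exact: beta_integralE.
  exact: measurable_EFin_beta_prime.
have e : Gamma a * Gamma b = Gamma (a + b) * beta_integral a b.
  apply: EFin_inj; apply: (etrans (EFinM _ _)).
  apply: (etrans (congr2 mule (GammaE a0) (GammaE b0))).
  apply: (etrans (Gamma_mul_beta_prime a b)).
  apply: (etrans (congr2 mule (esym (GammaE ab0)) (esym bt))).
  by apply/esym; exact: EFinM.
move: e; move: (Gamma a * Gamma b) (Gamma (a + b)) (Gamma_gt0 ab0) => X Y Y0 ->.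
by rewrite mulrAC divff ?mul1r// gt_eqF.
Qed.

Lemma beta_integral_gt0 (R : realType) (a b : R) : 0 < a -> 0 < b ->
  0 < beta_integral a b.
Proof.
by move=> a0 b0; rewrite beta_integral_Gamma// divr_gt0 ?mulr_gt0 ?Gamma_gt0 ?addr_gt0.
Qed.

(** * Settling of a scalar autonomous equation *)

(** The squared distance of two solutions has derivative
2 (y - x) (f y - f x) <= 0 and starts at 0. *)
Lemma is_solution_unique (R : realType) (f : R -> R) (x0 : R) (x y : R -> R) :
  {homo f : u v / u <= v >-> v <= u} ->
  is_solution f x0 x -> is_solution f x0 y ->
  forall t : R, 0 <= t -> y t = x t.
Proof.
move=> f_ninc [x00 cx dx] [y00 cy dy] t; rewrite le_eqVlt => /predU1P[<-|t0].
  by rewrite x00 y00.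
pose z := y - x; pose D := z * z.
have dD (s : R) : 0 < s -> is_derive s 1 D (2 * (y s - x s) * (f (y s) - f (x s))).
  move=> s0; have dz := is_deriveB (dy s s0) (dx s s0).
  apply: (is_derive_eq (is_deriveM dz dz)).
  by rewrite /GRing.scale/= /z !fctE; ring.
have sub0t : `[0, t] `<=` (`[0, +oo[ : set R).
  by move=> s /=; rewrite !in_itv/= andbT => /andP[].
have D0 : D 0 = 0 by rewrite /D /z !fctE x00 y00 subrr mulr0.
have : D t <= D 0.
  apply: (@ler0_derive1_le_cc _ D 0 t).
  - by move=> s; rewrite in_itv/= => /andP[s0 _]; have [] := dD _ s0.
  - move=> s; rewrite in_itv/= => /andP[s0 _]; rewrite derive1E.
    have [_ ->] := dD _ s0; rewrite -mulrA pmulr_rle0//.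
    have [xy|yx] := leP (x s) (y s).
      by rewrite mulr_ge0_le0 ?subr_ge0 ?subr_le0 ?f_ninc.
    by rewrite mulr_le0_ge0 ?subr_ge0 ?subr_le0 ?f_ninc ?ltW.
  - have cz : {within `[0, t], continuous z}.
      have cy' := continuous_subspaceW sub0t cy.
      have cx' := continuous_subspaceW sub0t cx.
      by move=> s; exact: (continuousB (cy' s) (cx' s)).
    by move=> s; exact: (continuousM (cz s) (cz s)).
  - by rewrite in_itv/= lexx ltW.
  - by rewrite in_itv/= lexx ltW.
  - exact: ltW.
rewrite D0 /D -expr2 => Dt.
have : z t ^+ 2 <= 0 by [].
rewrite le_eqVlt ltNge sqr_ge0 orbF sqrf_eq0 /z => /eqP/=.
by rewrite !fctE => /eqP; rewrite subr_eq0 => /eqP.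
Qed.

(** The equation x' = - g |x| sgn x, where F is the primitive of 1 / g vanishing at 0, that is,
F x is the time needed to descend from x to 0, and T is the supremum of F. *)
Section separable_decay.
Variables (R : realType) (g F : R -> R) (T : R).
Hypotheses (g0 : g 0 = 0) (g_gt0 : forall x : R, 0 < x -> 0 < g x).
Hypothesis g_nd : forall x y : R, 0 <= x -> x <= y -> g x <= g y.
Hypothesis g_cvg0 : g x @[x --> 0^'+] --> 0.
Hypotheses (F0 : F 0 = 0) (F_cvg0 : F x @[x --> 0^'+] --> 0).
Hypothesis dF : forall x : R, 0 < x -> is_derive x 1 F (g x)^-1.
Hypothesis F_le : forall x, F x <= T.
Hypothesis F_approx : forall e : R, 0 < e -> exists2 x : R, 0 < x & T - e < F x.

Let cF (x : R) : 0 < x -> {for x, continuous F}.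
Proof.
by move=> /dF[+ _]; move/derivable1_diffP/differentiable_continuous.
Qed.

Let cFw (x : R) : 0 < x -> {within `[0, x], continuous F}.
Proof.
move=> x0; apply/continuous_within_itvP => //; split.
- by move=> y; rewrite in_itv/= => /andP[y0 _]; exact: cF.
- by rewrite F0.
- by apply: cvg_at_left_filter; exact: cF.
Qed.

Let F_incr (x y : R) : 0 <= x -> x < y -> F x < F y.
Proof.
move=> x0 xy; have y0 := le_lt_trans x0 xy.
apply: (@gtr0_derive1_incr _ F 0 y) => //.
- by move=> z; rewrite in_itv/= => /andP[z0 _]; have [] := dF z0.
- move=> z; rewrite in_itv/= => /andP[z0 _]; rewrite derive1E.
  by have [_ ->] := dF z0; rewrite invr_gt0 g_gt0.
- exact: cFw.
Qed.

(** F is extended by the identity on the negative side so that it becomes a continuous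
injection of the line, to which the inverse function theorems apply also at 0. *)
Definition extend_id (x : R) : R := if x <= 0 then x else F x.
Local Notation E := extend_id.

Let E_le0 (x : R) : x <= 0 -> E x = x. Proof. by rewrite /E => ->. Qed.

Let E_ge0 (x : R) : 0 <= x -> E x = F x.
Proof.
rewrite le_eqVlt => /predU1P[<-|x0]; first by rewrite /E lexx F0.
by rewrite /E leNgt x0.
Qed.

Let F_ge0 (x : R) : 0 <= x -> 0 <= F x.
Proof.
rewrite le_eqVlt => /predU1P[<-|x0]; first by rewrite F0.
by rewrite -F0 ltW// F_incr.
Qed.

Let E_incr (x y : R) : x < y -> E x < E y.
Proof.
move=> xy; have [x0|x0] := leP 0 x.
  by rewrite !E_ge0 ?F_incr// (le_trans x0)// ltW.
rewrite (E_le0 (ltW x0)); have [y0|y0] := leP 0 y.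
  by rewrite E_ge0// (lt_le_trans x0)// F_ge0.
by rewrite E_le0// ltW.
Qed.

Let E_inj : injective E.
Proof.
move=> x y; have [xy|yx|//] := ltgtP x y.
  by move/eqP; rewrite lt_eqF// E_incr.
by move/eqP; rewrite gt_eqF// E_incr.
Qed.

Let cE (x : R) : {for x, continuous E}.
Proof.
have [x0|x0|->] := ltgtP x 0.
- rewrite /prop_for /continuous_at (E_le0 (ltW x0)).
  have : id y @[y --> x] --> x by exact: cvg_id.
  apply: cvg_trans; apply: near_eq_cvg.
  by near=> y; rewrite E_le0// ltW//; near: y; exact: lt_nbhsl.
- rewrite /prop_for /continuous_at E_ge0 ?(ltW x0)//.
  apply: cvg_trans (cF x0); apply: near_eq_cvg.
  near=> y; rewrite E_ge0// ltW//; near: y; exact: lt_nbhsr.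
- apply/left_right_continuousP; rewrite E_le0//; split.
    have : (x : R) @[x --> 0^'-] --> (0 : R) by apply: cvg_at_left_filter; exact: cvg_id.
    apply: cvg_trans; apply: near_eq_cvg.
    by near=> y; rewrite E_le0// ltW.
  apply: cvg_trans F_cvg0; apply: near_eq_cvg.
  by near=> y; rewrite E_ge0// ltW.
Unshelve. all: end_near. Qed.

(** On the range of the extension the default value 0 is never used. *)
Definition extend_inv (s : R) : R := xget 0 [set x | E x = s].
Local Notation Einv := extend_inv.

Let EK : cancel E Einv.
Proof.
move=> x; apply: E_inj; rewrite /Einv.
by case: xgetP => [y _ //|/(_ x) nx]; exfalso; exact: nx.
Qed.

(** The position when the time left before arrival is s, for a descent on the positive
side; it stays at 0 when s is negative. *)
Definition decay (s : R) : R := Num.max 0 (Einv s).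
Local Notation J := decay.

Let J_F (x : R) : 0 <= x -> J (F x) = x.
Proof. by move=> x0; rewrite /J -E_ge0// EK; apply/max_idPr. Qed.

Let J_le0 (s : R) : s <= 0 -> J s = 0.
Proof. by move=> s0; rewrite /J -(E_le0 s0) EK; apply/max_idPl. Qed.

Let J_ge0 (s : R) : 0 <= J s. Proof. by rewrite /J le_max lexx. Qed.

Let F_surj (s x : R) : 0 <= x -> 0 <= s <= F x -> exists2 y : R, 0 <= y & F y = s.
Proof.
rewrite le_eqVlt => /predU1P[<-|x0] /andP[s0 sx].
  by exists 0 => //; apply/eqP; rewrite eq_le F0 s0 -F0 sx.
have [|y] := @IVT _ F 0 x s (ltW x0) (cFw x0).
  by rewrite F0 min_l ?F_ge0 ?(ltW x0)// max_r ?F_ge0 ?(ltW x0)// s0.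
by rewrite in_itv/= => /andP[y0 _] <-; exists y.
Qed.

(** By the mean value theorem F x is x / g y for some y < x, and g is nondecreasing.  The
inequality forces the decay to arrive at 0 with speed 0. *)
Let le_mul_g (x : R) : 0 < x -> x <= F x * g x.
Proof.
move=> x0.
have dF' (y : R) : y \in `]0, x[ -> is_derive y 1 F (g y)^-1.
  by rewrite in_itv/= => /andP[y0 _]; exact: dF.
have [y] := MVT x0 dF' (cFw x0).
rewrite in_itv/= => /andP[y0 yx]; rewrite F0 !subr0 => ->.
rewrite mulrAC ler_peMl ?(ltW x0)// mulrC ler_pdivlMr ?g_gt0// mul1r.
by rewrite g_nd// ltW.
Qed.

Let Einv_continuous (x : R) : {for E x, continuous Einv}.
Proof.
have nK : {near x, cancel E Einv} by near=> y; exact: EK.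
have nE : {near x, continuous E} by near=> y; exact: cE.
by have /nbhs_singleton := near_can_continuous nK nE.
Unshelve. all: end_near. Qed.

Let is_derive_decay_pos (x : R) : 0 < x -> is_derive (F x) 1 J (g (J (F x))).
Proof.
move=> x0; rewrite J_F ?(ltW x0)// -E_ge0 ?(ltW x0)//.
have nK : {near x, cancel E Einv} by near=> y; exact: EK.
have nE : {near x, continuous E} by near=> y; exact: cE.
have dE : is_derive x 1 E (g x)^-1.
  apply: near_eq_is_derive (dF x0); near=> y; rewrite E_ge0// ltW//.
  near: y; exact: lt_nbhsr.
have gx0 : (g x)^-1 != 0 by rewrite gt_eqF// invr_gt0 g_gt0.
have cx : Einv @ nbhs (E x) --> x.
  by have := @Einv_continuous x; rewrite /prop_for /continuous_at EK.
have := is_derive_inverse nK nE dE gx0; rewrite invrK.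
apply: near_eq_is_derive; near=> s; rewrite /J.
suff s0 : 0 < Einv s by apply/esym/max_idPr/ltW.
by near: s; apply: (cvgr_gt _ cx).
Unshelve. all: end_near. Qed.

Let J_cvg0 : J s @[s --> 0] --> (0 : R).
Proof.
have c0 := @Einv_continuous 0; rewrite /prop_for /continuous_at E_le0// in c0.
have e0 : Einv 0 = 0 by rewrite -[X in Einv X](E_le0 (lexx 0)) EK.
rewrite e0 in c0.
apply/cvgr0Pnorm_lt => e e0'; near=> s.
rewrite ger0_norm ?J_ge0// /J gt_max e0' /=.
near: s; exact: (cvgr_lt _ c0).
Unshelve. all: end_near. Qed.

Let is_derive_decay0 : is_derive (0 : R) 1 J 0.
Proof.
have J0 : J 0 = 0 by exact: J_le0.
(* the slope J s / s lies between 0 and g (J s), which tends to 0; it is 0 at s = 0 *)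
apply/is_derive1_caratheodory; exists (fun s => J s / s); split.
- move=> s; rewrite J0 !subr0; have [->|s0] := eqVneq s 0.
    by rewrite J0 mul0r mulr0.
  by rewrite divfK.
- rewrite /prop_for /continuous_at J0 mul0r.
  apply/cvgr0Pnorm_lt => e e0.
  have he : \forall d \near 0^'+, g d < e by apply: (cvgr_lt _ g_cvg0).
  near (0 : R)^'+ => d.
  have gd : g d < e by near: d; exact: he.
  have d0 : 0 < d by [].
  near=> s.
  have Jd : J s < d by near: s; exact: (cvgr_lt _ J_cvg0).
  have sF1 : s <= F 1.
    by apply: ltW; near: s; apply: lt_nbhsl; rewrite -[ltLHS]F0 F_incr.
  have [s0|s0] := leP s 0; first by rewrite J_le0// mul0r normr0.
  have [||y y0 Fy] := @F_surj s 1; rewrite ?ler01 ?(ltW s0) ?sF1//.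
  rewrite ger0_norm ?divr_ge0 ?J_ge0 ?(ltW s0)//.
  apply: le_lt_trans gd; apply: (@le_trans _ _ (g (J s))); last first.
    by rewrite g_nd// ltW.
  rewrite ler_pdivrMr// -Fy J_F// mulrC le_mul_g//.
  by rewrite lt_neqAle y0 andbT; apply/eqP => y00; rewrite -Fy -y00 F0 ltxx in s0.
- by rewrite J0 mul0r.
Unshelve. all: end_near. Qed.

(** At s = 0 the two sides fit together because g 0 = 0. *)
Lemma is_derive_decay (s x : R) : 0 <= x -> s <= F x -> is_derive s 1 J (g (J s)).
Proof.
move=> x0 sx; have [s0|s0|->] := ltgtP s 0.
- rewrite J_le0 ?(ltW s0)// g0.
  apply: (near_eq_is_derive _ (is_derive_cst (0 : R) s (1 : R))).
  near=> u; rewrite J_le0// ltW//; near: u; exact: lt_nbhsl.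
- have [|y y0 Fy] := @F_surj s x x0; first by rewrite ltW.
  rewrite -Fy; apply: is_derive_decay_pos.
  by rewrite lt_neqAle y0 andbT; apply/eqP => y00; rewrite -Fy -y00 F0 ltxx in s0.
- by rewrite J_le0// g0; exact: is_derive_decay0.
Unshelve. all: end_near. Qed.

Let f (x : R) : R := - g `|x| * Num.sg x.

Let f_ninc : {homo f : u v / u <= v >-> v <= u}.
Proof.
have fp (u : R) : 0 <= u -> f u = - g u.
  rewrite /f le_eqVlt => /predU1P[<-|u0]; first by rewrite normr0 g0 oppr0 mul0r.
  by rewrite gtr0_norm// gtr0_sg// mulr1.
have fn (u : R) : u <= 0 -> f u = g (- u).
  rewrite /f le_eqVlt => /predU1P[->|u0]; first by rewrite normr0 oppr0 g0 oppr0 mul0r.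
  by rewrite ltr0_norm// ltr0_sg// mulrN1 opprK.
have g_ge0 (u : R) : 0 <= u -> 0 <= g u by move=> u0; rewrite -g0 g_nd.
move=> u v uv; have [u0|/ltW u0] := leP 0 u.
  by rewrite !fp ?(le_trans u0)// lerN2 g_nd.
rewrite (fn u)//; have [v0|/ltW v0] := leP 0 v.
  by rewrite fp// (@le_trans _ _ 0) ?oppr_le0 ?g_ge0// oppr_ge0.
by rewrite fn// g_nd ?oppr_ge0// lerN2.
Qed.

Definition flow (x0 t : R) : R := Num.sg x0 * J (F `|x0| - t).

Let is_derive_flow (x0 t : R) : 0 <= t -> is_derive t 1 (flow x0) (f (flow x0 t)).
Proof.
move=> t0; set s := F `|x0| - t.
have ss : s <= F `|x0| by rewrite /s gerDl oppr_le0.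
have dJ := is_derive_decay (normr_ge0 x0) ss.
have dl : is_derive t 1 (fun t => F `|x0| - t) (- 1).
  have := is_deriveB (is_derive_cst (F `|x0|) t (1 : R)) (is_derive_id t (1 : R)).
  by rewrite sub0r.
have h := @is_deriveZ _ _ _ _ (Num.sg x0) _ _ _
  (@is_derive1_comp R J (fun t => F `|x0| - t) t _ _ dJ dl).
apply: (is_derive_eq h); rewrite /f /flow -/s /GRing.scale/= normrM normr_sg.
rewrite sgrM sgr_id mulrN1.
have [->|x00] := eqVneq x0 0; first by rewrite sgr0 !mul0r mulr0.
rewrite mul1r; have := J_ge0 s; rewrite le_eqVlt => /predU1P[<-|Js0].
  by rewrite g0 sgr0 oppr0 !mulr0.
by rewrite (gtr0_norm Js0) (gtr0_sg Js0) mulr1; ring.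
Qed.

Let is_solution_flow x0 : is_solution f x0 (flow x0).
Proof.
split; first by rewrite /flow subr0 J_F// -numEsg.
- apply: derivable_within_continuous => t; rewrite in_itv/= andbT => t0.
  by have [] := is_derive_flow x0 t0.
- by move=> t t0; apply: is_derive_flow; exact: ltW.
Qed.

Let settling_time_flow x0 : settling_time (flow x0) = (F `|x0|)%:E.
Proof.
apply/eqP; rewrite eq_le; apply/andP; split.
  apply: ereal_inf_lbound; exists (F `|x0|) => //; split; first exact: F_ge0.
  by move=> t Ft; rewrite /flow J_le0 ?mulr0// subr_le0.
apply: le_ereal_inf_tmp => _ [t [t0 ht] <-]; rewrite lee_fin leNgt; apply/negP => tF.
have [x00|x00] := eqVneq x0 0; first by move: tF; rewrite x00 normr0 F0 ltNge t0.
have /eqP := ht t (lexx t); rewrite /flow mulf_eq0 sgr_eq0 (negbTE x00)/= => /eqP Js.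
have [||y y0 Fy] := @F_surj (F `|x0| - t) `|x0|; rewrite ?normr_ge0//.
  by rewrite subr_ge0 (ltW tF)/= gerDl oppr_le0.
move: Js; rewrite -Fy J_F// => y00; move: Fy; rewrite y00 F0 => /esym/eqP.
by rewrite subr_eq0 gt_eqF.
Qed.

(** The settling time of the trajectory from x0 is F |x0|. *)
Lemma separable_settling : exists phi : R -> R -> R, is_solution_map f phi /\
  ereal_sup [set settling_time (phi x0) | x0 in [set: R]] = T%:E.
Proof.
exists flow; split.
  move=> x0; split => [|y hy t t0]; first exact: is_solution_flow.
  exact: is_solution_unique f_ninc (is_solution_flow x0) hy t t0.
apply/eqP; rewrite eq_le; apply/andP; split.
  apply: ge_ereal_sup => _ [x0 _ <-]; rewrite settling_time_flow lee_fin.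
  exact: F_le.
apply/lee_addgt0Pr => e e0; have [x x0 Fx] := F_approx e0.
apply: (@le_trans _ _ (F x + e)%:E); first by rewrite lee_fin -lerBlDr ltW.
rewrite EFinD leeD2r//; apply: le_ereal_sup_tmp.
by exists (F x)%:E => //; exists x => //; rewrite settling_time_flow gtr0_norm.
Qed.
End separable_decay.

(** * The system with exponents p, q and k *)

Lemma cvg_at_right0 (R : realType) (f : R -> R) :
  f x @[x --> 0^'+] --> 0 -> (forall x : R, 0 < x -> 0 < f x) ->
  f x @[x --> 0^'+] --> 0^'+.
Proof.
move=> f0 fp U hU.
have h : \forall x \near 0^'+, 0 < f x -> U (f x) by exact: f0 _ hU.
suff : \forall x \near 0^'+, U (f x) by [].
by near=> x; have : 0 < f x -> U (f x); [near: x; exact: h|apply; exact: fp].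
Unshelve. all: end_near. Qed.

Section fixed_time.
Variables (R : realType) (p q k : R).
Hypotheses (hp : 0 < p) (hq : 0 < q) (hk : 0 < k).
Hypotheses (hkp : k * p < 1) (hkq : 1 < k * q).

Local Notation a := (mp p q k).
Local Notation b := (mq p q k).

Let qp0 : 0 < q - p.
Proof. by rewrite subr_gt0 -(ltr_pM2l hk) (lt_trans hkp). Qed.

Let a0 : 0 < a. Proof. by rewrite divr_gt0// subr_gt0. Qed.

Let b0 : 0 < b. Proof. by rewrite divr_gt0// subr_gt0. Qed.

Let qp_neq0 : q - p != 0. Proof. by rewrite gt_eqF. Qed.

Lemma mpDmq : a + b = k.
Proof. by rewrite /mp /mq; field. Qed.

Lemma oneB_kp : 1 - p * k = (q - p) * a.
Proof. by rewrite /mp; field. Qed.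

Lemma kqB_one : q * k - 1 = (q - p) * b.
Proof. by rewrite /mq; field. Qed.

Lemma K_beta : K p q k = beta_integral a b / (q - p).
Proof.
rewrite beta_integral_Gamma// mpDmq /K.
move: (Gamma a) (Gamma b) (Gamma k) (Gamma_gt0 hk) => A B C C0.
by field; rewrite qp_neq0 gt_eqF.
Qed.

Lemma gain_beta (alpha beta : R) : 0 < alpha -> 0 < beta ->
  gain p q k alpha beta =
  beta_integral a b / (alpha `^ k * (q - p)) * (alpha / beta) `^ a.
Proof.
move=> al0 be0; rewrite beta_integral_Gamma// mpDmq /gain.
move: (Gamma a) (Gamma b) (Gamma k) (Gamma_gt0 hk) => A B C C0.
move: ((alpha / beta) `^ a) (alpha `^ k) (powR_gt0 k al0) => D E E0.
by field; rewrite qp_neq0 !gt_eqF.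
Qed.

Section settling.
Variables (Tc alpha beta : R).
Hypotheses (hTc : 0 < Tc) (al0 : 0 < alpha) (be0 : 0 < beta).

Let Bt0 : 0 < beta_integral a b. Proof. exact: beta_integral_gt0. Qed.

(** The time needed to descend from x to 0. *)
Definition arrival (x : R) : R :=
  Tc / beta_integral a b * beta_cdf a b (beta / alpha * x `^ (q - p)).

Let speed (x : R) : R :=
  gain p q k alpha beta / Tc * (alpha * x `^ p + beta * x `^ q) `^ k.

Let gain0 : 0 < gain p q k alpha beta.
Proof. by rewrite gain_beta// mulr_gt0 ?powR_gt0 ?divr_gt0 ?mulr_gt0 ?powR_gt0. Qed.

Let gT0 : 0 < gain p q k alpha beta / Tc. Proof. by rewrite divr_gt0. Qed.

Let sum_gt0 (x : R) : 0 < x -> 0 < alpha * x `^ p + beta * x `^ q.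
Proof. by move=> x0; rewrite addr_gt0 ?mulr_gt0 ?powR_gt0. Qed.

Let sum_ge0 (x : R) : 0 <= alpha * x `^ p + beta * x `^ q.
Proof. by rewrite addr_ge0// mulr_ge0 ?powR_ge0// ltW. Qed.

Let w_gt0 (x : R) : 0 < x -> 0 < beta / alpha * x `^ (q - p).
Proof. by move=> x0; rewrite mulr_gt0 ?powR_gt0 ?divr_gt0. Qed.

Let speed_cvg0 : speed x @[x --> 0^'+] --> 0.
Proof.
rewrite -[X in _ --> X](mulr0 (gain p q k alpha beta / Tc)).
apply: cvgM; first exact: cvg_cst.
have h : alpha * x `^ p + beta * x `^ q @[x --> (0 : R)^'+] --> (0 : R)^'+.
  apply: cvg_at_right0 => //.
  rewrite -[X in _ --> X](addr0 0); apply: cvgD.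
    rewrite -[X in _ --> X](mulr0 alpha).
    by apply: cvgM; [exact: cvg_cst|exact: powR_cvg0].
  rewrite -[X in _ --> X](mulr0 beta).
  by apply: cvgM; [exact: cvg_cst|exact: powR_cvg0].
exact: cvg_comp h (powR_cvg0 hk).
Qed.

Let arrival_cvg0 : arrival x @[x --> 0^'+] --> 0.
Proof.
rewrite -[X in _ --> X](mulr0 (Tc / beta_integral a b)).
apply: cvgM; first exact: cvg_cst.
have h : beta / alpha * x `^ (q - p) @[x --> (0 : R)^'+] --> (0 : R)^'+.
  apply: cvg_at_right0 => //.
  rewrite -[X in _ --> X](mulr0 (beta / alpha)).
  by apply: cvgM; [exact: cvg_cst|exact: powR_cvg0].
exact: cvg_comp h (beta_cdf_cvg0 a0 b0).
Qed.

(** The chain rule gives Tc / B times the beta prime density at w times dw / dx, where B is the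
Beta integral.  It is the inverse speed because
alpha x ^ p + beta x ^ q = alpha x ^ p (1 + w). *)
Let is_derive_arrival (x : R) : 0 < x -> is_derive x 1 arrival (speed x)^-1.
Proof.
move=> x0; have w0 := w_gt0 x0.
have dw := @is_deriveZ _ _ _ _ (beta / alpha) _ _ _ (is_derive1_powR (q - p) x0).
have dB := @is_derive1_comp R (beta_cdf a b)
  (fun x => beta / alpha * x `^ (q - p)) x _ _ (is_derive_beta_cdf a0 b0 w0) dw.
have dF := @is_deriveZ _ _ _ _ (Tc / beta_integral a b) _ _ _ dB.
apply: (is_derive_eq dF); rewrite /GRing.scale/= /speed gain_beta//.
have -> : alpha * x `^ p + beta * x `^ q =
    alpha * x `^ p * (1 + beta / alpha * x `^ (q - p)).
  have -> : x `^ q = x `^ p * x `^ (q - p).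
    by rewrite -powRD ?subrKC// (gt_eqF x0) implybT.
  by field; rewrite gt_eqF.
rewrite /beta_prime mpDmq !powR_subr1// powRN.
have -> : (beta / alpha * x `^ (q - p)) `^ a =
    ((alpha / beta) `^ a)^-1 * (x / x `^ (p * k)).
  rewrite powRM ?powR_ge0 ?divr_ge0 ?ltW// -powRrM -oneB_kp.
  rewrite powRB ?powRr1 ?(ltW x0) ?(gt_eqF x0) ?implybT//; congr (_ * _).
  rewrite -powRN -mulN1r [RHS]powRrM powR_inv1 ?divr_ge0 ?ltW//.
  by rewrite invf_div.
rewrite [(alpha * x `^ p * _) `^ k]powRM ?mulr_ge0 ?powR_ge0 ?addr_ge0 ?(ltW w0) ?(ltW al0)//.
rewrite [(alpha * x `^ p) `^ k]powRM ?powR_ge0 ?(ltW al0)//.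
rewrite -powRrM.
set W := 1 + _; have W0 : 0 < W by rewrite addr_gt0.
set Z := x `^ (q - p); have Z0 : 0 < Z by exact: powR_gt0.
have := powR_gt0 k W0; have := powR_gt0 k al0; have := powR_gt0 (p * k) x0.
have := powR_gt0 a (divr_gt0 al0 be0).
move: ((alpha / beta) `^ a) (x `^ (p * k)) (alpha `^ k) (W `^ k) => A B C D A0 B0 C0 D0.
by field; rewrite qp_neq0 !gt_eqF.
Qed.

Lemma fixed_time_settling : exists phi : R -> R -> R,
  is_solution_map (vector_field p q k Tc alpha beta) phi /\
  ereal_sup [set settling_time (phi x0) | x0 in [set: R]] = Tc%:E.
Proof.
have -> : vector_field p q k Tc alpha beta = fun x => - speed `|x| * Num.sg x.
  by apply/funext => x; rewrite /vector_field /speed mulNr.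
apply: (@separable_settling R speed arrival Tc).
- by rewrite /speed !powR0 ?gt_eqF// !mulr0 addr0 powR0 ?mulr0// gt_eqF.
- by move=> x x0; rewrite mulr_gt0// powR_gt0// sum_gt0.
- move=> x y x0 xy; have y0 := le_trans x0 xy.
  rewrite /speed; move: (gain p q k alpha beta / Tc) gT0 => G G0.
  rewrite (ler_pM2l G0); apply: ge0_ler_powR.
  + exact: ltW.
  + by rewrite nnegrE.
  + by rewrite nnegrE.
  by rewrite lerD// ler_pM2l// ge0_ler_powR ?nnegrE ?(ltW hp) ?(ltW hq).
- exact: speed_cvg0.
- by rewrite /arrival powR0 ?gt_eqF// mulr0 beta_cdf0 mulr0.
- exact: arrival_cvg0.
- exact: is_derive_arrival.
- move=> x; rewrite /arrival mulrAC ler_pdivrMr// ler_pM2l//.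
  exact: beta_cdf_le_total.
- move=> e e0.
  have e'0 : 0 < e * beta_integral a b / Tc by rewrite divr_gt0// mulr_gt0.
  have [w w0 hw] := beta_cdf_approx a0 b0 0 e'0.
  have w'0 : 0 < w * alpha / beta by rewrite divr_gt0// mulr_gt0.
  (* the point x at which (beta / alpha) x ^ (q - p) is w *)
  exists ((w * alpha / beta) `^ (q - p)^-1); first exact: powR_gt0.
  rewrite /arrival -powRrM mulVf// powRr1 ?(ltW w'0)//.
  have -> : beta / alpha * (w * alpha / beta) = w by field; rewrite !gt_eqF.
  move: hw; move: (beta_integral a b) Bt0 (beta_cdf a b w) => B B0 C hw.
  have -> : Tc - e = Tc / B * (B - e * B / Tc) by field; rewrite !gt_eqF.
  by rewrite ltr_pM2l// divr_gt0.
Qed.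
End settling.

(** * The upper bound as a function of the scaling parameter *)

(** The dependence of Tmax on rho, without the factor Tc / K. *)
Definition scaling_cost (rho : R) : R :=
  (rho `^ (2 * a) * (1 - p * k))^-1 + rho `^ (2 * (k - a)) / (q * k - 1).

Lemma TmaxE (Tc rho : R) : 0 < rho ->
  Tmax p q k Tc rho = Tc / K p q k * scaling_cost rho.
Proof.
move=> r0; have ri0 : 0 < rho^-1 by rewrite invr_gt0.
rewrite /Tmax gain_beta// K_beta /scaling_cost oneB_kp kqB_one.
have -> : (rho / rho^-1) `^ a = rho `^ (2 * a).
  by rewrite invrK -expr2 -powR_mulrn ?(ltW r0)// -powRrM.
have -> : rho^-1 `^ k = (rho `^ k)^-1.
  by rewrite -powR_inv1 ?(ltW r0)// -powRrM mulN1r powRN.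
have -> : rho `^ (2 * (k - a)) = rho `^ k * rho `^ k / rho `^ (2 * a).
  rewrite -powRD ?(gt_eqF r0) ?implybT// -powRB ?(gt_eqF r0) ?implybT//.
  by congr (_ `^ _); ring.
move: (beta_integral a b) (beta_integral_gt0 a0 b0) => B B0.
move: (rho `^ k) (rho `^ (2 * a)) (powR_gt0 k r0) (powR_gt0 (2 * a) r0).
move=> C D C0 D0; move: a a0 b b0 => A A0 M M0.
by field; rewrite qp_neq0 !gt_eqF.
Qed.

Let KC (rho : R) : scaling_cost rho =
  (rho `^ (2 * a))^-1 / ((q - p) * a) + rho `^ (2 * b) / ((q - p) * b).
Proof.
rewrite /scaling_cost oneB_kp kqB_one invfM; congr (_ + _ `^ (2 * _) / _).
by apply/eqP; rewrite subr_eq addrC mpDmq.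
Qed.

Lemma scaling_cost1 : scaling_cost 1 = (1 - p * k)^-1 + (q * k - 1)^-1.
Proof. by rewrite /scaling_cost powR1 !mul1r. Qed.

(** Since 1 - p k = (q - p) a and q k - 1 = (q - p) b, the terms in ln rho of the two lower
bounds 1 - 2 a ln rho and 1 + 2 b ln rho cancel. *)
Lemma scaling_cost_min (rho : R) : 0 < rho -> rho != 1 ->
  scaling_cost 1 < scaling_cost rho.
Proof.
move=> r0 r1; rewrite scaling_cost1 KC oneB_kp kqB_one.
have l0 : ln rho != 0 by rewrite ln_eq0.
have ha : 1 - 2 * a * ln rho < (rho `^ (2 * a))^-1.
  rewrite -powRN /powR gt_eqF// mulNr; apply: expR_gt1Dx.
  by rewrite oppr_eq0 mulf_neq0// gt_eqF// mulr_gt0.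
have hb : 1 + 2 * b * ln rho < rho `^ (2 * b).
  rewrite /powR gt_eqF//; apply: expR_gt1Dx.
  by rewrite mulf_neq0// gt_eqF// mulr_gt0.
have -> : ((q - p) * a)^-1 + ((q - p) * b)^-1 =
    (1 - 2 * a * ln rho) / ((q - p) * a) + (1 + 2 * b * ln rho) / ((q - p) * b).
  move: a b a0 b0 => A B A0 B0.
  by field; rewrite qp_neq0 !gt_eqF.
by rewrite ltrD// ltr_pM2r// invr_gt0 mulr_gt0.
Qed.

Lemma K_gt0 : 0 < K p q k.
Proof. by rewrite K_beta divr_gt0// beta_integral_gt0. Qed.

(** Multiplied by q - p, this says that the Beta integral is less than 1 / a + 1 / b. *)
Lemma K_lt_scaling_cost1 : K p q k < scaling_cost 1.
Proof.
rewrite scaling_cost1 oneB_kp kqB_one K_beta ltr_pdivrMr//.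
apply: (lt_le_trans (beta_integral_lt a0 b0)).
move: a b a0 b0 => A B A0 B0.
rewrite le_eqVlt; apply/orP; left; apply/eqP.
by field; rewrite qp_neq0 !gt_eqF.
Qed.

Lemma scaling_cost_cvg0 : scaling_cost rho @[rho --> 0^'+] --> +oo.
Proof.
have h : (rho `^ (2 * a))^-1 / ((q - p) * a) @[rho --> (0 : R)^'+] --> +oo.
  apply: gt0_cvgMly; first by rewrite invr_gt0 mulr_gt0.
  apply/cvgrVy; first by near=> r; rewrite powR_gt0.
  by apply: powR_cvg0; rewrite mulr_gt0.
apply: ger_cvgy h; near=> r; rewrite KC lerDl.
by rewrite divr_ge0 ?powR_ge0// ltW// mulr_gt0.
Unshelve. all: end_near. Qed.

Lemma scaling_cost_cvgy : scaling_cost rho @[rho --> +oo] --> +oo.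
Proof.
have h : rho `^ (2 * b) / ((q - p) * b) @[rho --> (+oo : set_system R)] --> +oo.
  apply: gt0_cvgMly; first by rewrite invr_gt0 mulr_gt0.
  by apply: cvg_powR_pinfty; rewrite mulr_gt0.
apply: ger_cvgy h; near=> r; rewrite KC lerDr.
by rewrite divr_ge0 ?invr_ge0 ?powR_ge0// ltW// mulr_gt0.
Unshelve. all: end_near. Qed.

End fixed_time.

Theorem mainTheorem4 (R : realType) (p q k Tc : R)
    (hp : 0 < p) (hq : 0 < q) (hk : 0 < k)
    (hkp : k * p < 1) (hkq : 1 < k * q) (hTc : 0 < Tc) :
  (forall rho : R, 0 < rho ->
     Tmax p q k Tc rho =
       Tc / K p q k
       * ((rho `^ (2 * mp p q k) * (1 - p * k))^-1
          + rho `^ (2 * (k - mp p q k)) / (q * k - 1)))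
  /\ (forall rho : R, 0 < rho ->
        exists phi : R -> R -> R,
          is_solution_map (vector_field p q k Tc rho rho^-1) phi /\
          ereal_sup [set settling_time (phi x0) | x0 in [set: R]] = Tc%:E)
  /\ (Tmax p q k Tc rho @[rho --> 0^'+] --> +oo
      /\ Tmax p q k Tc rho @[rho --> +oo] --> +oo)
  /\ (argmin [set rho : R | 0 < rho] (Tmax p q k Tc) = [set 1]
      /\ is_min [set rho : R | 0 < rho] (Tmax p q k Tc) (Tmax p q k Tc 1)
      /\ Tmax p q k Tc 1
         = Tc / K p q k * ((1 - p * k)^-1 + (q * k - 1)^-1)
      /\ Tc < Tmax p q k Tc 1).
Proof.
have TE (rho : R) : 0 < rho ->
    Tmax p q k Tc rho = Tc / K p q k * scaling_cost p q k rho.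
  by move=> r0; exact: TmaxE.
have KP : 0 < K p q k by exact: K_gt0.
have TK0 : 0 < Tc / K p q k by rewrite divr_gt0.
have T_min (rho : R) : 0 < rho -> rho != 1 -> Tmax p q k Tc 1 < Tmax p q k Tc rho.
  by move=> r0 r1; rewrite !TE// ltr_pM2l//; exact: scaling_cost_min.
have T_min' (rho : R) : 0 < rho -> Tmax p q k Tc 1 <= Tmax p q k Tc rho.
  by move=> r0; have [->//|r1] := eqVneq rho 1; rewrite ltW// T_min.
split; first exact: TE.
split; first by move=> rho r0; apply: fixed_time_settling => //; rewrite invr_gt0.
split.
  split.
    have h : Tc / K p q k * scaling_cost p q k r @[r --> 0^'+] --> +oo.
      by apply: gt0_cvgMry => //; exact: scaling_cost_cvg0.
    move: h; apply: cvg_trans; apply: near_eq_cvg; near=> r.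
    by rewrite TE.
  have h : Tc / K p q k * scaling_cost p q k r @[r --> +oo] --> +oo.
    by apply: gt0_cvgMry => //; exact: scaling_cost_cvgy.
  move: h; apply: cvg_trans; apply: near_eq_cvg; near=> r.
  by rewrite TE//; near: r; apply: nbhs_pinfty_gt; exact: num_real.
split.
  apply/seteqP; split => [r [/= r0 rmin]|r ->]; last first.
    by split => /=; [exact: ltr01|exact: T_min'].
  apply/eqP/negPn/negP => r1; have := rmin 1 ltr01.
  by rewrite leNgt T_min.
split.
  split; first by exists 1 => //=; exact: ltr01.
  by move=> _ [r /= r0 <-]; exact: T_min'.
rewrite TE// scaling_cost1; split=> //.
rewrite -scaling_cost1 mulrAC ltr_pdivlMr// ltr_pM2l//.
exact: K_lt_scaling_cost1.
Unshelve. all: end_near. Qed.
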